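(* Let $\mathcal R$ be a self-complemented reconstruction function outputting sc-voters of size at most $\lambda$, with $\lambda<m$. For any distribution $D$ on $\mathcal X\times\{-1,1\}$, any prior $P$ on $\mathcal I_\lambda\times\Sigma_\lambda$ and any $\delta\in(0,1]$, with probability at least $1-\delta$ over $S\sim D^m$, for all posteriors $Q$ aligned on $P$, $$R_D(G_{Q,S})\ \le\ R_S(G_{Q,S})+\sqrt{\frac1{2(m-\lambda)}\Big[4\lambda+\ln\frac{\xi(m-\lambda)}{\delta}\Big]}.$$
   Context: $S=((x_i,y_i))_{i=1}^m$; $\mathcal I_\lambda$ is the set of index sequences $(i_1,\dots,i_k)$, $0\le k\le\lambda$, $i_j\in\{1,\dots,m\}$; $\Sigma_\lambda=\{-1,1\}^\lambda$; $S_{\mathbf i}$ the subsequence of $S$ indexed by $\mathbf i$. A reconstruction function $\mathcal R$ maps $(S_{\mathbf i},\boldsymbol\sigma)$ to a voter $\mathcal X\to[-1,1]$ depending only on $S_{\mathbf i},\boldsymbol\sigma$; it is self-complemented if $\mathcal R(S_{\mathbf i},-\boldsymbol\sigma)=-\mathcal R(S_{\mathbf i},\boldsymbol\sigma)$ for all $S$, $\mathbf i$, $\boldsymbol\sigma$. $Q$ on $\mathcal I_\lambda\times\Sigma_\lambda$ is aligned on $P$ if $Q(\mathbf i,\boldsymbol\sigma)+Q(\mathbf i,-\boldsymbol\sigma)=P(\mathbf i,\boldsymbol\sigma)+P(\mathbf i,-\boldsymbol\sigma)$ for all $(\mathbf i,\boldsymbol\sigma)$. $P$ is fixed before seeing $S$.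 $R_{D'}(G_{Q,S})=\mathbb E_{(\mathbf i,\boldsymbol\sigma)\sim Q}\mathbb E_{(x,y)\sim D'}\tfrac12(1-y\,\mathcal R(S_{\mathbf i},\boldsymbol\sigma)(x))$ for $D'\in\{D,S\}$. $\xi(n)=\sum_{k=0}^n\binom nk(k/n)^k(1-k/n)^{n-k}$. *)

(* Defs.v *)
From HB Require Import structures.
From mathcomp Require Import all_boot all_order all_algebra.
From mathcomp Require Import all_classical all_reals all_analysis.
Set Implicit Arguments. Unset Strict Implicit. Unset Printing Implicit Defensive.
Import Order.TTheory GRing.Theory Num.Theory.
Local Open Scope classical_set_scope.
Local Open Scope ring_scope.

(* label in {-1,1} encoded as a bool *)
Definition lab {R : realType} (b : bool) : R := if b then 1 else -1.

(* index sequences (i_1,...,i_k), 0 <= k <= lam, i_j in {1..m} (0-based here) *)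
Definition idx_seq (m lam : nat) := {k : 'I_lam.+1 & k.-tuple 'I_m}.

Definition msg_space (m lam : nat) := (idx_seq m lam * lam.-tuple bool)%type.

Definition subsample {T : Type} {m lam : nat} (S : m.-tuple T) (i : idx_seq m lam)
  : seq T := map (tnth S) (tagged i).

Definition negsig {lam : nat} (s : lam.-tuple bool) : lam.-tuple bool :=
  map_tuple negb s.

Definition is_fdist {R : realType} {T : finType} (Q : T -> R) : Prop :=
  (forall t, 0 <= Q t) /\ \sum_(t : T) Q t = 1.

Definition aligned {R : realType} {m lam : nat} (Q P : msg_space m lam -> R) : Prop :=
  forall i s, Q (i, s) + Q (i, negsig s) = P (i, s) + P (i, negsig s).

Definition self_complemented {X T : Type} {R : realType} {lam : nat}
  (Rc : seq T -> lam.-tuple bool -> X -> R) : Prop :=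
  forall s sig, Rc s (negsig sig) = (fun x => - Rc s sig x).

Definition loss {X : Type} {R : realType} (h : X -> R) (z : X * bool) : R :=
  (1 - lab z.2 * h z.1) / 2.

Definition true_risk {d} {X : measurableType d} {R : realType} {m lam : nat}
  (D : probability (X * bool)%type R) (Rc : seq (X * bool) -> lam.-tuple bool -> X -> R)
  (Q : msg_space m lam -> R) (S : m.-tuple (X * bool)) : R :=
  \sum_(p : msg_space m lam)
     Q p * Rintegral D setT (loss (Rc (subsample S p.1) p.2)).

Definition emp_risk {X : Type} {R : realType} {m lam : nat}
  (Rc : seq (X * bool) -> lam.-tuple bool -> X -> R)
  (Q : msg_space m lam -> R) (S : m.-tuple (X * bool)) : R :=
  \sum_(p : msg_space m lam)
     Q p * ((m%:R)^-1 * \sum_(j < m) loss (Rc (subsample S p.1) p.2) (tnth S j)).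

Definition xi {R : realType} (n : nat) : R :=
  \sum_(k < n.+1) 'C(n, k)%:R * ((k%:R / n%:R) ^+ k * (1 - k%:R / n%:R) ^+ (n - k)).

(* Pm is the m-fold product D^m: it agrees with the product of D on
   measurable rectangles (this characterizes D^m uniquely) *)
Definition is_iid_product {d} {Z : measurableType d} {R : realType} {m : nat}
  (D : probability Z R) (Pm : probability (m.-tuple Z) R) : Prop :=
  forall A : 'I_m -> set Z, (forall i, measurable (A i)) ->
    Pm [set t | forall i, A i (tnth t i)] = (\prod_(i < m) D (A i))%E.

(* Main.v *)
(** Let n = m - lam, and let gap q be the true risk minus the empirical risk of
    the voter q. For a posterior Q aligned on P, self-complementation makes
    gap ^ 2 even under sign reversal, so Jensen's inequality gives
      exp (2 n (E_Q gap)^2) <= exp (2 n E_P gap^2) <= E_P exp (2 n gap^2),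
    whose right-hand side does not depend on Q: Markov's inequality reduces the
    theorem to E_S exp (2 n gap^2) <= exp (4 lam) xi(n) for each fixed voter.
    Keep n sample points that avoid the compression sequence; dropping the lam
    others costs the factor exp (4 lam). Resampling the kept points one at a
    time and bounding the convex function by its chords replaces the losses by
    Bernoulli variables of the same mean p, which leaves the binomial sum
      sum_k C(n,k) p^k (1-p)^(n-k) exp (2 n (k/n - p)^2),
    bounded termwise by that of xi(n) by Pinsker's inequality. *)

Require Import Defs.
From HB Require Import structures.
From mathcomp Require Import all_boot all_order all_algebra.
From mathcomp Require Import all_classical all_reals all_analysis.
From mathcomp Require Import measurable_realfun ring lra.
Import Order.TTheory GRing.Theory Num.Theory.
Import numFieldNormedType.Exports.
Local Open Scope classical_set_scope.
Local Open Scope ring_scope.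

(** * Pinsker's inequality for Bernoulli laws, in exponentiated form *)

Section BinaryPinsker.
Context {R : realType}.
Implicit Types (p q t y u : R) (k l n : nat).

Let tilt k l t : R :=
  t ^+ k * (1 - t) ^+ l * expR (2 * (k + l)%:R * (k%:R / (k + l)%:R - t) ^+ 2).

Let dtilt k l t : R := ((k%:R * t ^+ k.-1) * (1 - t) ^+ l
  - t ^+ k * (l%:R * (1 - t) ^+ l.-1)
  - t ^+ k * (1 - t) ^+ l * (4 * (k + l)%:R * (k%:R / (k + l)%:R - t))) *
  expR (2 * (k + l)%:R * (k%:R / (k + l)%:R - t) ^+ 2).

Let is_derive_tilt k l t : is_derive t 1 (tilt k l) (dtilt k l t).
Proof.
have -> : tilt k l = id ^+ k * (cst 1 - id) ^+ l *
  (expR \o ((2 * (k + l)%:R) \*: (cst (k%:R / (k + l)%:R) - id) ^+ 2)).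
  by apply/funext => x; rewrite /tilt /= !exprfctE.
apply: is_derive_eq.
rewrite /dtilt /= !(exprfctE, mulrfctE, addrfctE, opprfctE) /GRing.scale /= !expr1.
set e := expR _; set c := k%:R / _.
ring.
Qed.

Lemma mulr_natX_pred k t : t != 0 -> k%:R * t ^+ k.-1 = k%:R * t ^+ k / t.
Proof.
by case: k => [|k] t0; rewrite ?mul0r// exprSr mulrA mulfK.
Qed.

(** With [n = k + l] and [q = k / n], the logarithmic derivative is [k/t - l/(1-t) - 4n(q-t) =
    n(q-t)(1 - 4t(1-t)) / (t(1-t))], and [1 - 4t(1-t)] is the square of [1 - 2t]. *)
Let dtiltE k l t : (0 < k + l)%N -> 0 < t -> t < 1 ->
  dtilt k l t = (k%:R / (k + l)%:R - t) *
    ((1 - 2 * t) ^+ 2 / (t * (1 - t)) * (k + l)%:R * tilt k l t).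
Proof.
move=> n0 t0 t1; have nt : t != 0 by rewrite gt_eqF.
have n1t : 1 - t != 0 by rewrite gt_eqF ?subr_gt0.
have nn : (k + l)%:R != 0 :> R by rewrite pnatr_eq0 -lt0n.
rewrite /dtilt /tilt (mulr_natX_pred k _ nt) (mulr_natX_pred l _ n1t).
move: (expR _) (t ^+ k) ((1 - t) ^+ l) => e a b.
rewrite natrD in nn *; move: (k%:R : R) (l%:R : R) nn => x y nn.
by field; rewrite nn nt n1t.
Qed.

(* The derivative of the left-hand side in p has the sign of k/n - p, so its
   maximum is at p = k/n; working with t ^+ k instead of ln t covers the
   endpoints p = 0, 1 and k = 0, n. *)
Lemma binary_pinsker k l p : (0 < k + l)%N -> 0 <= p <= 1 ->
  p ^+ k * (1 - p) ^+ l * expR (2 * (k + l)%:R * (k%:R / (k + l)%:R - p) ^+ 2)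
  <= (k%:R / (k + l)%:R) ^+ k * (1 - k%:R / (k + l)%:R) ^+ l.
Proof.
move=> n0 /andP[p0 p1]; set q := k%:R / _.
have nn : 0 < (k + l)%:R :> R by rewrite ltr0n.
have q0 : 0 <= q by rewrite divr_ge0.
have q1 : q <= 1 by rewrite ler_pdivrMr// mul1r ler_nat leq_addr.
have -> : q ^+ k * (1 - q) ^+ l = tilt k l q.
  by rewrite /tilt -/q subrr expr0n/= mulr0 expR0 mulr1.
rewrite -/(tilt k l p).
have dt x : derivable (tilt k l) x 1 by case: (is_derive_tilt k l x).
have ct a b : {within `[a, b], continuous (tilt k l)}.
  apply: derivable_within_continuous => x _; exact: dt.
have d1 x : derive1 (tilt k l) x = dtilt k l x.
  by rewrite derive1E; apply: derive_val.
have pos x : 0 < x -> x < 1 ->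
    0 <= (1 - 2 * x) ^+ 2 / (x * (1 - x)) * (k + l)%:R * tilt k l x.
  move=> x0 x1; have x1' : 0 <= 1 - x by rewrite subr_ge0 ltW.
  have tx : 0 <= tilt k l x.
    by rewrite !mulr_ge0 ?expR_ge0 ?exprn_ge0// ltW.
  apply: mulr_ge0 => //; apply: mulr_ge0 => //; apply: mulr_ge0; first exact: sqr_ge0.
  by rewrite invr_ge0 mulr_ge0// ltW.
have [pq|qp] := leP p q.
  apply: (@ger0_derive1_ndecr _ (tilt k l) p q) => // x; rewrite in_itv/= => /andP[px xq].
  have x0 : 0 < x by exact: le_lt_trans px.
  have x1 : x < 1 by exact: lt_le_trans q1.
  by rewrite d1 dtiltE// mulr_ge0 ?pos// subr_ge0 ltW.
apply: (@ler0_derive1_nincr _ (tilt k l) q p) => //; last exact: ltW.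
move=> x; rewrite in_itv/= => /andP[qx xp].
have x0 : 0 < x by exact: le_lt_trans qx.
have x1 : x < 1 by exact: lt_le_trans p1.
by rewrite d1 dtiltE// mulr_le0_ge0 ?pos// subr_le0 ltW.
Qed.

End BinaryPinsker.

(** * Binomial expectations and the convexity of the exponential squared deviation *)

Section BinomialMean.
Context {R : realType}.
Implicit Types (p q t y u : R) (k l n : nat) (psi : R -> R -> R).

(** Averages over one more Bernoulli([p]) trial added to the running sum [y]. The mean [p] stays an
    argument of [psi] because it will itself depend on the sample. *)
Definition bernoulli_step psi p y := p * psi p (y + 1) + (1 - p) * psi p y.

Lemma iter_bernoulli_step n psi p y :
  iter n bernoulli_step psi p y =
  \sum_(k < n.+1) 'C(n, k)%:R * (p ^+ k * (1 - p) ^+ (n - k)) * psi p (y + k%:R).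
Proof.
elim: n y => [|n IHn] y.
  by rewrite big_ord_recl big_ord0 /= bin0 !expr0 !mul1r !addr0.
rewrite iterS /bernoulli_step !IHn.
rewrite [RHS]big_ord_recl /= bin0 expr0 mul1r subn0 addr0.
(* Pascal's rule separates success and failure of one trial. *)
under [X in _ = _ + X]eq_bigr => k _.
  rewrite /bump leq0n add1n binS natrD subSS mulrDl mulrDl; over.
rewrite big_split /= addrCA addrA addrC; congr (_ + _).
  rewrite big_distrr; apply: eq_bigr => k _ /=.
  have -> : y + k.+1%:R = y + 1 + k%:R by rewrite -natr1; ring.
  by rewrite exprS; ring.
rewrite [in RHS]big_ord_recr /= bin_small// !mul0r addr0.
rewrite big_ord_recl /= bin0 expr0 subn0 addr0 mulrDr [RHS]addrC; congr (_ + _).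
  by rewrite exprS; ring.
rewrite big_distrr; apply: eq_bigr => k _ /=.
rewrite /bump leq0n add1n -[in RHS](subnSK (ltn_ord k)) [(1 - p) ^+ _.+1]exprS.
ring.
Qed.

Definition exp_sqdev n p y := expR (2 * n%:R * (y / n%:R - p) ^+ 2).

Lemma expR_ge_tangent t u : expR t * (1 + (u - t)) <= expR u.
Proof.
rewrite -[X in _ <= expR X](subrK t) [X in _ <= expR X]addrC expRD.
by rewrite ler_wpM2l ?expR_ge0 ?expR_ge1Dx.
Qed.

(** The exponent is a convex quadratic in [y], and [expR] is increasing and convex. *)
Lemma exp_sqdev_chord n p y u : 0 <= u <= 1 ->
  exp_sqdev n p (y + u) <= u * exp_sqdev n p (y + 1) + (1 - u) * exp_sqdev n p y.
Proof.
move=> /andP[u0 u1]; rewrite /exp_sqdev.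
set f := fun x : R => 2 * n%:R * (x / n%:R - p) ^+ 2.
rewrite -!/(f _); set c := u * f (y + 1) + (1 - u) * f y.
have fc : f (y + u) <= c.
  (* Over a unit interval, a quadratic lies below its chord by its leading coefficient times
     [u (1 - u)]. *)
  rewrite -subr_ge0 (_ : _ - _ = 2 * n%:R * n%:R^-1 ^+ 2 * (u * (1 - u))).
    by rewrite !mulr_ge0 ?sqr_ge0 ?subr_ge0.
  by rewrite /c /f; ring.
apply: (@le_trans _ _ (expR c)); first by rewrite ler_expR.
(* In the average with weights [u] and [1 - u], the linear terms of the two tangent bounds at [c]
   cancel. *)
have h1 := expR_ge_tangent c (f (y + 1)); have h2 := expR_ge_tangent c (f y).
have u1' : 0 <= 1 - u by rewrite subr_ge0.
apply: le_trans (lerD (ler_wpM2l u0 h1) (ler_wpM2l u1' h2)).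
by rewrite le_eqVlt; apply/orP; left; apply/eqP; rewrite /c; ring.
Qed.

Lemma binomial_exp_sqdev_le_xi n p : (0 < n)%N -> 0 <= p <= 1 ->
  iter n bernoulli_step (exp_sqdev n) p 0 <= xi n.
Proof.
move=> n0 p01; rewrite iter_bernoulli_step /xi; apply: ler_sum => -[k kn] _ /=.
rewrite -mulrA ler_wpM2l// add0r /exp_sqdev.
have E : (k + (n - k) = n)%N by rewrite subnKC.
by have := @binary_pinsker R k (n - k)%N p; rewrite E => /(_ n0 p01).
Qed.

Lemma xi_gt0 n : 0 < xi n :> R.
Proof.
(* The term [k = 0] equals 1, and the others are nonnegative. *)
rewrite /xi big_ord_recl /= bin0 mul0r expr0 subr0 expr1n !mulr1 ltr_pwDl//.
apply: sumr_ge0 => k _; rewrite !mulr_ge0 ?exprn_ge0 ?divr_ge0//.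
have n0 : (0 < n)%N by case: n k => // -[].
by rewrite subr_ge0 ler_pdivrMr ?ltr0n// mul1r ler_nat; case: k.
Qed.

End BinomialMean.

(** * Invariance of the product law under redrawing one coordinate *)

Section Resampling.
Context {d : measure_display} {Z : measurableType d} {R : realType} {m : nat}.
Implicit Types (S : m.-tuple Z) (j : 'I_m) (z : Z).

Definition set_tnth S j z : m.-tuple Z :=
  [tuple if i == j then z else tnth S i | i < m].

Lemma tnth_set_tnth S j z i :
  tnth (set_tnth S j z) i = if i == j then z else tnth S i.
Proof. by rewrite tnth_mktuple. Qed.

Lemma measurable_set_tnth j :
  measurable_fun [set: m.-tuple Z * Z] (fun Sz => set_tnth Sz.1 j Sz.2).
Proof.
apply/measurable_fun_tnthP => i.
rewrite (_ : _ \o _ = fun Sz : m.-tuple Z * Z => if i == j then Sz.2 else tnth Sz.1 i);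
  last by apply/funext => Sz /=; rewrite tnth_set_tnth.
case: (i == j); first exact: measurable_snd.
by apply: (measurableT_comp (measurable_tnth i)); exact: measurable_fst.
Qed.

Definition box (A : 'I_m -> set Z) : set (m.-tuple Z) :=
  [set t | forall i, A i (tnth t i)].

Lemma measurable_box (A : 'I_m -> set Z) :
  (forall i, measurable (A i)) -> measurable (box A).
Proof.
move=> mA; rewrite (_ : box A = \big[setI/setT]_(i < m) ((@tnth m Z)^~ i @^-1` A i)).
  apply: bigsetI_measurable => i _.
  by rewrite -[X in measurable X]setTI; exact: measurable_tnth.
apply/seteqP; split => [t At|t].
  by rewrite -bigcap_seq => i _; exact: At.
by rewrite -bigcap_seq => h i; apply: h => /=; rewrite mem_index_enum.
Qed.

(** The boxes are stable under intersection and generate the sigma-algebra of tuples, so uniqueness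
    of measures applies. *)
Lemma eq_measure_box (mu nu : {measure set (m.-tuple Z) -> \bar R}) :
  (mu setT < +oo)%E ->
  (forall A, (forall i, measurable (A i)) -> mu (box A) = nu (box A)) ->
  forall A, measurable A -> mu A = nu A.
Proof.
move=> muT munu; pose G := [set box A | A in [set A | forall i, measurable (A i)]].
apply: (measure_unique G (fun=> setT)) => //.
- apply/seteqP; split.
    apply: smallest_sub; first exact: smallest_sigma_algebra.
    rewrite -bigcup_seq => B [i _ [C mC <-]]; apply: sub_sigma_algebra.
    exists (fun k => if k == i then C else setT).
      by move=> k /=; case: ifP.
    apply/seteqP; split => t /=.
      by move=> /(_ i); rewrite eqxx.
    by move=> [_ Ct] k; case: eqP => // ->.
  apply: smallest_sub; first exact: sigma_algebra_measurable.
  by move=> _ [A mA <-]; exact: measurable_box.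
- move=> _ _ [A mA <-] [B mB <-]; exists (fun i => A i `&` B i).
    by move=> i; exact: measurableI.
  apply/seteqP; split => t /=.
    by move=> h; split => i; case: (h i).
  by move=> [hA hB] i; split; [exact: hA|exact: hB].
- by move=> _; exists (fun=> setT) => //; apply/seteqP; split.
- by apply/seteqP; split => // t _; exists 0%N.
- by move=> _ [A mA <-]; exact: munu.
Qed.

Variables (D : probability Z R) (Dm : probability (m.-tuple Z) R).
Hypothesis Dm_prod : is_iid_product D Dm.

(** Replacing coordinate [j] of a sample by an independent draw gives a sample with the same law;
    change of variables and Tonelli's theorem then give the iterated integral. *)
Lemma integral_resample j (F : m.-tuple Z -> \bar R) :
  measurable_fun [set: m.-tuple Z] F -> (forall S, 0 <= F S)%E ->
  (\int[Dm]_S F S = \int[Dm]_S \int[D]_z F (set_tnth S j z))%E.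
Proof.
move=> mF F0.
pose phi (Sz : m.-tuple Z * Z) := set_tnth Sz.1 j Sz.2.
have mphi : measurable_fun setT phi by exact: measurable_set_tnth.
pose phi' : {mfun (m.-tuple Z * Z)%type >-> m.-tuple Z} :=
  HB.pack phi (isMeasurableFun.Build _ _ _ _ _ mphi).
have pushE A : measurable A -> Dm A = pushforward (Dm \x D)%E phi' A.
  apply: (@eq_measure_box Dm (pushforward (Dm \x D)%E phi')).
    by rewrite [X in (X < _)%E]probability_setT ltry.
  (* The old coordinate [j] becomes unconstrained and the fresh point takes over its constraint: the
     preimage of [box A] is [box A'] times [A j]. *)
  move=> {}A mA; pose A' i := if i == j then setT else A i.
  have mA' i : measurable (A' i) by rewrite /A'; case: ifP.
  rewrite [RHS](_ : _ = (Dm \x D)%E (box A' `*` A j)).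
    rewrite [RHS]product_measure1E//; last exact: measurable_box.
    rewrite [LHS](Dm_prod _ mA) [X in (_ = X * _)%E](Dm_prod _ mA').
    rewrite (bigD1 j)//= [in RHS](bigD1 j)//= /A' eqxx.
    rewrite probability_setT mul1e muleC; congr (_ * _)%E.
    by apply: eq_bigr => i /negbTE ->.
  congr ((Dm \x D)%E _); apply/seteqP; split => -[S z] /=.
    rewrite /phi /= => h; split => [i|].
      by have := h i; rewrite tnth_set_tnth /A'; case: eqP.
    by have := h j; rewrite tnth_set_tnth eqxx.
  move=> [h Az] i; rewrite /phi /= tnth_set_tnth.
  by have := h i; rewrite /A'; case: eqP => // ->.
transitivity (\int[pushforward (Dm \x D)%E phi']_S F S)%E.
  by apply: eq_measure_integral => A mA _; exact: pushE.
rewrite ge0_integral_pushforward//.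
rewrite preimage_setT (fubini_tonelli1 (F \o phi))//.
  exact: measurableT_comp.
by move=> x; exact: F0.
Qed.

End Resampling.

Lemma probability_integrable01 d (T : measurableType d) (R : realType)
    (P : probability T R) (f : T -> R) :
  measurable_fun setT f -> (forall x, 0 <= f x <= 1) ->
  P.-integrable setT (EFin \o f).
Proof.
move=> mf f01; apply: measurable_bounded_integrable => //.
  by rewrite [X in (X < _)%E]probability_setT ltry.
exists 1; split => // M M1 x _ /=; have /andP[f0 f1] := f01 x.
by rewrite ger0_norm// (le_trans f1)// ltW.
Qed.

(** * Exponential moment of the deviation for a sample-dependent loss *)

Section ExpectedDeviation.
Context {d : measure_display} {Z : measurableType d} {R : realType} {m : nat}.
Implicit Types (S : m.-tuple Z) (j : 'I_m) (z : Z) (psi : R -> R -> R).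
Variables (D : probability Z R) (Dm : probability (m.-tuple Z) R).
Hypothesis Dm_prod : is_iid_product D Dm.
Variable w : m.-tuple Z -> Z -> R.
Hypothesis w01 : forall S z, 0 <= w S z <= 1.
Hypothesis mw : measurable_fun [set: m.-tuple Z * Z] (fun Sz => w Sz.1 Sz.2).

(** With [w S z] read as the loss at [z] of the voter built from [S], this is the true risk of that
    voter. *)
Let p S : R := \int[D]_z w S z.

Let mwS S : measurable_fun setT (w S).
Proof. exact: (measurableT_comp mw (measurable_pair1 S)). Qed.

Let intw S : D.-integrable setT (EFin \o w S).
Proof. by apply: probability_integrable01. Qed.

Let EFin_p S : (p S)%:E = (\int[D]_z (w S z)%:E)%E.
Proof. by rewrite /p fineK//; exact: (integrable_fin_num measurableT (intw S)). Qed.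

Lemma mean01 S : 0 <= p S <= 1.
Proof.
apply/andP; split; first by apply: Rintegral_ge0 => z _; case/andP: (w01 S z).
rewrite -lee_fin EFin_p -(@probability_setT _ _ _ D) -[leRHS]mul1e -integral_cst//.
apply: ge0_le_integral => //.
- by move=> z _; rewrite lee_fin; case/andP: (w01 S z).
- exact/measurable_EFinP.
- by move=> z _; rewrite lee_fin; case/andP: (w01 S z).
Qed.

#[local] Hint Resolve mean01 : core.

Lemma measurable_mean : measurable_fun [set: m.-tuple Z] p.
Proof.
apply/measurable_EFinP.
rewrite (_ : _ \o _ = fubini_F D (fun Sz : m.-tuple Z * Z => (w Sz.1 Sz.2)%:E));
  last by apply/funext => S; rewrite /= EFin_p.
apply: measurable_fun_fubini_tonelli_F; first exact/measurable_EFinP.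
by move=> x; rewrite lee_fin; case/andP: (w01 x.1 x.2).
Qed.

#[local] Hint Resolve measurable_mean : core.

(** The chord is affine in the loss, so integrating it only replaces the loss by its mean. *)
Lemma integral_chord psi S y : 0 <= psi (p S) (y + 1) -> 0 <= psi (p S) y ->
  (\int[D]_z (w S z * psi (p S) (y + 1) + (1 - w S z) * psi (p S) y)%:E
   = (bernoulli_step psi (p S) y)%:E)%E.
Proof.
move=> a0 b0.
under eq_integral do rewrite EFinD.
rewrite ge0_integralD//; last 4 first.
- by move=> z _; rewrite lee_fin mulr_ge0//; case/andP: (w01 S z).
- by apply/measurable_EFinP; apply: measurable_funM.
- by move=> z _; rewrite lee_fin mulr_ge0// subr_ge0; case/andP: (w01 S z).
- by apply/measurable_EFinP; apply: measurable_funM => //; apply: measurable_funB.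
have intw' : D.-integrable setT (EFin \o (fun z => 1 - w S z)).
  apply: probability_integrable01; first exact: measurable_funB.
  by move=> z; have := w01 S z; lra.
rewrite /bernoulli_step EFinD; congr (_ + _)%E.
  under eq_integral do rewrite EFinM muleC.
  rewrite integralZl//; last exact: intw.
  by rewrite EFinM EFin_p muleC.
under eq_integral do rewrite EFinM muleC.
rewrite integralZl//.
rewrite EFinM muleC; congr (_ * _)%E.
rewrite -[LHS]fineK; last exact: (integrable_fin_num measurableT intw').
congr EFin; rewrite -[LHS]/(\int[D]_z (1 - w S z)) RintegralB//; last first.
  by apply: probability_integrable01 => // z; rewrite ler01 lexx.
by rewrite Rintegral_cst// [X in fine X]probability_setT mul1r.
Qed.

(* Each index of L is resampled in turn; by the chord inequality the resampled
   loss may be replaced by a Bernoulli variable of the same mean. *)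
Lemma integral_le_bernoulli (L : seq 'I_m) psi (M : R) :
  uniq L -> (forall j S z, j \in L -> w (set_tnth S j z) = w S) ->
  measurable_fun [set: R * R] (fun py => psi py.1 py.2) ->
  (forall q y, 0 <= q <= 1 -> 0 <= psi q y) ->
  (forall q y u, 0 <= q <= 1 -> 0 <= u <= 1 ->
    psi q (y + u) <= u * psi q (y + 1) + (1 - u) * psi q y) ->
  (forall q, 0 <= q <= 1 -> iter (size L) bernoulli_step psi q 0 <= M) ->
  (\int[Dm]_S (psi (p S) (\sum_(j <- L) w S (tnth S j)))%:E <= M%:E)%E.
Proof.
elim: L psi => [|j L IHL] psi.
  move=> _ _ mpsi psi0 _ psiM; under eq_integral do rewrite big_nil.
  apply: (@le_trans _ _ (\int[Dm]_S (cst M%:E) S)%E); last first.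
    by rewrite integral_cst// [X in (_ * X)%E]probability_setT mule1.
  apply: ge0_le_integral => //.
  - by move=> S _; rewrite lee_fin psi0.
  - apply/measurable_EFinP.
    exact: (measurableT_comp mpsi
      (measurable_fun_pair measurable_mean (measurable_cst _))).
  - by move=> S _; rewrite lee_fin psiM.
move=> /andP[jL uL] wL mpsi psi0 psi_chord; rewrite [size _]/= iterSr => psiM.
have wL' i S z : i \in L -> w (set_tnth S i z) = w S.
  by move=> iL; apply: wL; rewrite inE iL orbT.
have wj S z : w (set_tnth S j z) = w S by apply: wL; rewrite inE eqxx.
(* Redrawing point [j] changes neither the voter, nor its mean, nor the partial sum [Y] over the
   other kept points: only the loss at [j] varies. *)
have pj S z : p (set_tnth S j z) = p S by rewrite /p wj.
pose Y S := \sum_(i <- L) w S (tnth S i).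
have Yj S z : Y (set_tnth S j z) = Y S.
  rewrite /Y; apply: eq_big_seq => i iL; rewrite wj tnth_set_tnth.
  by case: eqP iL jL => // -> ->.
have mwi i : measurable_fun [set: m.-tuple Z] (fun S => w S (tnth S i)).
  have mg : measurable_fun [set: m.-tuple Z] (fun S => (S, tnth S i)).
    by apply: measurable_fun_pair => //; exact: measurable_tnth.
  exact: (measurableT_comp mw mg).
have mY : measurable_fun [set: m.-tuple Z] Y by apply: measurable_sum.
have mpsi2 (f : m.-tuple Z -> R) : measurable_fun [set: m.-tuple Z] f ->
    measurable_fun [set: m.-tuple Z] (fun S => psi (p S) (f S)).
  by move=> mf; exact: (measurableT_comp mpsi (measurable_fun_pair measurable_mean mf)).
have mstep : measurable_fun [set: m.-tuple Z] (fun S => bernoulli_step psi (p S) (Y S)).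
  apply: measurable_funD; apply: measurable_funM => //; last exact: mpsi2.
    by apply: mpsi2; exact: measurable_funD.
  exact: measurable_funB.
under eq_integral do rewrite big_cons -/(Y _).
rewrite (integral_resample _ _ Dm_prod j); last 2 first.
- apply/measurable_EFinP; apply: mpsi2; exact: measurable_funD.
- by move=> S; rewrite lee_fin psi0.
apply: (@le_trans _ _ (\int[Dm]_S (bernoulli_step psi (p S) (Y S))%:E)%E).
  apply: ge0_le_integral => //.
  - by move=> S _; apply: integral_ge0 => z _; rewrite lee_fin psi0.
  - apply: (measurable_fun_fubini_tonelli_F (fun Sz : m.-tuple Z * Z =>
      (psi (p (set_tnth Sz.1 j Sz.2)) (w (set_tnth Sz.1 j Sz.2)
        (tnth (set_tnth Sz.1 j Sz.2) j) + Y (set_tnth Sz.1 j Sz.2)))%:E)).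
      apply/measurable_EFinP.
      exact: (measurableT_comp (mpsi2 _ (measurable_funD (mwi j) mY))
        (measurable_set_tnth j)).
    by move=> x; rewrite lee_fin psi0.
  - by apply/measurable_EFinP; exact: mstep.
  move=> S _; rewrite -integral_chord ?psi0//; apply: ge0_le_integral => //.
  - by move=> z _; rewrite lee_fin psi0.
  - apply/measurable_EFinP.
    under eq_fun do rewrite pj wj Yj tnth_set_tnth eqxx.
    have mg : measurable_fun [set: Z] (fun z => (p S, w S z + Y S)).
      by apply: measurable_fun_pair => //; exact: measurable_funD.
    exact: (measurableT_comp mpsi mg).
  - apply/measurable_EFinP; apply: measurable_funD; apply: measurable_funM => //.
    exact: measurable_funB.
  - move=> z _; rewrite lee_fin pj wj Yj tnth_set_tnth eqxx [_ + Y S]addrC.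
    exact: psi_chord.
(* The induction continues with [bernoulli_step psi], a mixture of [psi] at [y + 1] and at [y],
   which inherits measurability, positivity and the chord inequality. *)
apply: IHL => //.
- have m1 : measurable_fun [set: R * R] (fun py => psi py.1 (py.2 + 1)).
    have mg : measurable_fun [set: R * R] (fun py => (py.1, py.2 + 1)).
      by apply: measurable_fun_pair => //; exact: measurable_funD.
    exact: (measurableT_comp mpsi mg).
  apply: measurable_funD; apply: measurable_funM => //.
  exact: measurable_funB.
- move=> q y q01; have /andP[q0 q1] := q01.
  by rewrite addr_ge0// mulr_ge0 ?psi0// subr_ge0.
- move=> q y u q01 u01; have /andP[q0 q1] := q01.
  have q1' : 0 <= 1 - q by rewrite subr_ge0.
  have h1 := psi_chord q y u q01 u01; have h2 := psi_chord q (y + 1) u q01 u01.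
  rewrite /bernoulli_step [y + u + 1]addrAC.
  apply: le_trans (lerD (ler_wpM2l q0 h2) (ler_wpM2l q1' h1)) _.
  by rewrite le_eqVlt; apply/orP; left; apply/eqP; ring.
Qed.

Lemma measurable_exp_sqdev n :
  measurable_fun [set: R * R] (fun py => exp_sqdev n py.1 py.2).
Proof.
apply: (measurableT_comp (@measurable_expR R)); apply: measurable_funM => //.
apply: measurable_funX; apply: measurable_funB => //.
exact: measurable_funM.
Qed.

Lemma integral_exp_sqdev_le_xi (L : seq 'I_m) :
  uniq L -> (0 < size L)%N -> (forall j S z, j \in L -> w (set_tnth S j z) = w S) ->
  (\int[Dm]_S (exp_sqdev (size L) (p S) (\sum_(j <- L) w S (tnth S j)))%:E
   <= (xi (size L))%:E)%E.
Proof.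
move=> uL L0 wL; apply: integral_le_bernoulli => //.
- exact: measurable_exp_sqdev.
- by move=> *; exact: expR_ge0.
- by move=> *; exact: exp_sqdev_chord.
- by move=> q q01; exact: binomial_exp_sqdev_le_xi.
Qed.

End ExpectedDeviation.

(** Markov's inequality at level [a / delta], passed to the complementary event. *)
Lemma probability_le_markov d (T : measurableType d) (R : realType)
    (P : probability T R) (f : T -> R) (a delta : R) :
  measurable_fun setT f -> (forall x, 0 <= f x) ->
  0 < a -> 0 < delta -> (\int[P]_x (f x)%:E <= a%:E)%E ->
  ((1 - delta)%:E <= P [set x | (f x <= a / delta)%R])%E.
Proof.
move=> mf f0 a0 delta0 fa.
pose X : {RV P >-> R} := HB.pack f (isMeasurableFun.Build _ _ _ _ _ mf).
have e0 : 0 < a / delta by rewrite divr_gt0.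
have := @markov _ _ _ P X id (a / delta) e0 (@measurable_id _ _ _)
  (fun _ h => h) (fun _ _ _ _ h => h).
set B := [set x | _].
have mB : measurable B.
  rewrite (_ : B = f @^-1` `[a / delta, +oo[).
    by rewrite -[X in measurable X]setTI; exact: (mf measurableT).
  by apply/seteqP; split => x; rewrite /B /= in_itv/= andbT lee_fin ger0_norm.
have EX : ('E_P[(id \o [eta Num.Def.normr]) \o X] <= a%:E)%E.
  rewrite unlock; apply: le_trans fa; rewrite le_eqVlt; apply/orP; left; apply/eqP.
  by apply: eq_integral => x _ /=; rewrite ger0_norm.
move=> /le_trans => /(_ _ EX) PB.
have PB' : (P B <= delta%:E)%E.
  rewrite -(@lee_pmul2l _ (a / delta)%:E) ?lte_fin//.
  by rewrite -EFinM divfK ?gt_eqF.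
apply: (@le_trans _ _ (P (~` B))).
  rewrite probability_setC// EFinB leeB// .
apply: le_measure; rewrite ?inE//.
- exact: measurableC.
- rewrite -[X in measurable X]setTI (_ : [set x | _] = f @^-1` `]-oo, a / delta]).
    exact: (mf measurableT).
  by apply/seteqP; split => x; rewrite /= in_itv.
- move=> x; rewrite /B /= lee_fin ger0_norm// => /negP; rewrite -ltNge; exact: ltW.
Qed.

(** * Cost of the dropped points, Jensen's inequalities and alignment *)

Section Deviation.
Context {R : realType}.
Implicit Types (n m : nat) (p V W : R).

(** [V] is the loss on the kept points and [W] the loss on all of them. With [a = V/n - p],
    [b = W/(n+lam) - V/n] and [t = lam/(n+lam)], one has [|a| <= 1] and [|b| <= t], so the exponent
    grows by at most [2n(2t + t^2)], which is at most [4 lam]. *)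
Lemma exp_sqdev_drop n (lam : nat) p V W :
  (0 < n)%N -> 0 <= p <= 1 -> 0 <= V <= n%:R -> V <= W <= V + lam%:R ->
  expR (2 * n%:R * (p - (n + lam)%:R^-1 * W) ^+ 2) <=
  expR (4 * lam%:R) * exp_sqdev n p V.
Proof.
move=> n0 /andP[p0 p1] /andP[V0 Vn] /andP[VW WV].
rewrite /exp_sqdev -expRD ler_expR natrD.
have : 0 < n%:R :> R by rewrite ltr0n.
have : 0 <= lam%:R :> R by [].
move: (n%:R : R) (lam%:R : R) V0 Vn VW WV => x l V0 Vn VW WV l0 x0.
have m0 : 0 < x + l by rewrite ltr_wpDr.
pose t := l / (x + l); pose a := V / x - p; pose b := (x + l)^-1 * W - V / x.
have t0 : 0 <= t by rewrite divr_ge0// ltW.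
have xE : x * t = l * (1 - t) by rewrite /t; field; rewrite gt_eqF.
have Vx0 : 0 <= V / x by rewrite divr_ge0// ltW.
have Vx1 : V / x <= 1 by rewrite ler_pdivrMr// mul1r.
(* The numerator is a difference of two numbers in [[0, l]], whence [|b| <= t]. *)
have bE : b = ((W - V) - l * (V / x)) / (x + l).
  by rewrite /b; field; rewrite !gt_eqF.
have lV0 : 0 <= l * (V / x) by rewrite mulr_ge0.
have lV1 : l * (V / x) <= l by rewrite ler_piMr.
have bt : b <= t by rewrite bE ler_pM2r ?invr_gt0//; lra.
have tb : - t <= b by rewrite bE /t -mulNr ler_pM2r ?invr_gt0//; lra.
have -> : p - (x + l)^-1 * W = - (a + b) by rewrite /a /b; ring.
rewrite sqrrN -/a.
have a1 : a <= 1 by rewrite /a; lra.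
have a1' : - 1 <= a by rewrite /a; lra.
have ab : a * b <= t by nra.
have bb : b ^+ 2 <= t ^+ 2 by nra.
have : 2 * x * (2 * (a * b) + b ^+ 2) <= 2 * x * (2 * t + t ^+ 2).
  by rewrite ler_wpM2l ?mulr_ge0 ?(ltW x0)//; lra.
have -> : 2 * x * (2 * t + t ^+ 2) = 2 * (x * t) * (2 + t) by ring.
rewrite xE.
(* The constant 4 comes from [(1 - t)(2 + t) = 2 - t - t^2 <= 2]. *)
have : 2 * (l * (1 - t)) * (2 + t) <= 4 * l.
  have := mulr_ge0 l0 t0; have := mulr_ge0 l0 (sqr_ge0 t); rewrite expr2; lra.
have -> : 2 * x * (a + b) ^+ 2 = 2 * x * a ^+ 2 + 2 * x * (2 * (a * b) + b ^+ 2).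
  by ring.
lra.
Qed.

(** The variance of [f] under [Q] is nonnegative. *)
Lemma sqr_mean_le (T : finType) (Q f : T -> R) : is_fdist Q ->
  (\sum_t Q t * f t) ^+ 2 <= \sum_t Q t * f t ^+ 2.
Proof.
move=> [Q0 Q1]; move cE : (\sum_t Q t * f t) => c.
have : 0 <= \sum_t Q t * (f t - c) ^+ 2.
  by apply: sumr_ge0 => t _; rewrite mulr_ge0 ?sqr_ge0.
have -> : \sum_t Q t * (f t - c) ^+ 2 =
    \sum_t Q t * f t ^+ 2 - 2 * c * (\sum_t Q t * f t) + c ^+ 2 * \sum_t Q t.
  rewrite !big_distrr/= -sumrB -big_split/=; apply: eq_bigr => t _; ring.
rewrite Q1 cE; nra.
Qed.

(** Averaging the tangent of [expR] at the mean leaves its value there. *)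
Lemma expR_mean_le (T : finType) (Q f : T -> R) : is_fdist Q ->
  expR (\sum_t Q t * f t) <= \sum_t Q t * expR (f t).
Proof.
move=> [Q0 Q1]; move cE : (\sum_t Q t * f t) => c.
have -> : expR c = \sum_t Q t * (expR c * (1 + (f t - c))).
  transitivity (expR c * ((1 - c) * \sum_t Q t + \sum_t Q t * f t)).
    by rewrite Q1 cE; ring.
  rewrite mulrDr !big_distrr/= -big_split/=; apply: eq_bigr => t _; ring.
by apply: ler_sum => t _; rewrite ler_wpM2l// expR_ge_tangent.
Qed.

Lemma negsigK lam : involutive (@negsig lam).
Proof.
by move=> s; apply: eq_from_tnth => i; rewrite !tnth_map negbK.
Qed.

(** Pairing each message with its negation, twice the sum depends only on the pair weights, which
    alignment makes equal. *)
Lemma aligned_sum_even m lam (Q P f : msg_space m lam -> R) :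
  aligned Q P -> (forall i s, f (i, negsig s) = f (i, s)) ->
  \sum_q Q q * f q = \sum_q P q * f q.
Proof.
move=> QP feven.
suff E (A : msg_space m lam -> R) : 2 * \sum_q A q * f q =
    \sum_(i : idx_seq m lam) \sum_(s : lam.-tuple bool)
      (A (i, s) + A (i, negsig s)) * f (i, s).
  have /(mulfI _) : 2 * \sum_q Q q * f q = 2 * \sum_q P q * f q.
    by rewrite !E; apply: eq_bigr => i _; apply: eq_bigr => s _; rewrite QP.
  by apply; rewrite pnatr_eq0.
have -> : \sum_q A q * f q =
    \sum_(i : idx_seq m lam) \sum_(s : lam.-tuple bool) A (i, s) * f (i, s).
  by rewrite pair_big/=; apply: eq_bigr => -[].
rewrite mulr_natl mulr2n -big_split/=; apply: eq_bigr => i _.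
rewrite [X in _ + X](reindex_inj (inv_inj (@negsigK lam)))/= -big_split/=.
by apply: eq_bigr => s _; rewrite feven mulrDl.
Qed.

End Deviation.

(** * Losses, and indices outside the compression sequence *)

Lemma loss01 (X : Type) (R : realType) (h : X -> R) (z : X * bool) :
  -1 <= h z.1 <= 1 -> 0 <= loss h z <= 1.
Proof. by rewrite /loss /lab; case: z.2; lra. Qed.

Lemma lossN (X : Type) (R : realType) (h : X -> R) (z : X * bool) :
  loss (fun x => - h x) z = 1 - loss h z.
Proof. by rewrite /loss; lra. Qed.

Lemma subsample_set_tnth d (Z : measurableType d) m lam (S : m.-tuple Z)
    (i : idx_seq m lam) j z :
  j \notin tval (tagged i) -> subsample (set_tnth S j z) i = subsample S i.
Proof.
move=> ji; apply/eq_in_map => k ki; rewrite tnth_set_tnth.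
by case: eqP ki ji => // -> ->.
Qed.

Lemma exists_uniq_avoiding m lam k (t : k.-tuple 'I_m) : (k <= lam)%N ->
  exists L : seq 'I_m, [/\ uniq L, size L = (m - lam)%N &
    forall j, j \in L -> j \notin tval t].
Proof.
move=> klam; pose F := [seq j <- enum 'I_m | j \notin tval t].
have sF : (m - lam <= size F)%N.
  rewrite leq_subLR; apply: leq_trans (leq_add klam (leqnn _)).
  rewrite /F size_filter -[X in (X <= _)%N](size_enum_ord m).
  rewrite -[in X in (X <= _)%N](count_predC (mem (tval t)) (enum 'I_m)) leq_add2r.
  rewrite -size_filter -[X in (_ <= X)%N](size_tuple t).
  apply: uniq_leq_size; first by rewrite filter_uniq ?enum_uniq.
  by move=> j; rewrite mem_filter => /andP[].
(* Truncation gives exactly [m - lam] indices, even if the compression sequence is short or has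
   repetitions. *)
exists (take (m - lam) F); split.
- by rewrite take_uniq// filter_uniq ?enum_uniq.
- by rewrite size_takel.
- by move=> j /mem_take; rewrite mem_filter => /andP[].
Qed.

(** * The gap between true and empirical risk of one voter *)

Section RiskGap.
Context {R : realType} {d : measure_display} {X : measurableType d} {m lam : nat}.
Variable Rc : seq (X * bool) -> lam.-tuple bool -> X -> R.
Hypothesis Rc_sc : self_complemented Rc.
Hypothesis Rc_bnd : forall s sig x, -1 <= Rc s sig x <= 1.
Hypothesis Rc_meas : forall (k : nat) (sig : lam.-tuple bool),
  measurable_fun setT (fun tx : k.-tuple (X * bool) * X => Rc (val tx.1) sig tx.2).
Variables (D : probability (X * bool)%type R) (Dm : probability (m.-tuple (X * bool)) R).
Hypothesis Dm_prod : is_iid_product D Dm.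
Hypothesis lam_lt_m : (lam < m)%N.
Implicit Types (S : m.-tuple (X * bool)) (q : msg_space m lam).

Let vloss q S z : R := loss (Rc (subsample S q.1) q.2) z.

Definition risk_gap q S : R :=
  \int[D]_z loss (Rc (subsample S q.1) q.2) z -
  m%:R^-1 * \sum_(j < m) loss (Rc (subsample S q.1) q.2) (tnth S j).

Let vloss01 q S z : 0 <= vloss q S z <= 1.
Proof. exact: loss01. Qed.

Let measurable_vloss q : measurable_fun [set: m.-tuple (X * bool) * (X * bool)]
  (fun Sz => vloss q Sz.1 Sz.2).
Proof.
(* [Rc_meas] concerns tuples of fixed length, so the subsample is written as a tuple of the length
   of [i]. *)
case: q => i sig.
have mg : measurable_fun [set: m.-tuple (X * bool) * (X * bool)]
    (fun Sz => (map_tuple (tnth Sz.1) (tagged i), Sz.2.1)).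
  apply: measurable_fun_pair; last exact: measurableT_comp.
  apply/measurable_fun_tnthP => k.
  rewrite (_ : _ \o _ = fun Sz => tnth Sz.1 (tnth (tagged i) k)).
    exact: (measurableT_comp (measurable_tnth _) measurable_fst).
  by apply/funext => Sz /=; rewrite tnth_map.
have mR := measurableT_comp (Rc_meas _ sig) mg.
apply: measurable_funM => //; apply: measurable_funB => //.
apply: measurable_funM; last exact: mR.
have mlab : measurable_fun [set: bool] (@lab R) by [].
exact: (measurableT_comp mlab (measurableT_comp measurable_snd measurable_snd)).
Qed.

Lemma measurable_risk_gap q : measurable_fun [set: m.-tuple (X * bool)] (risk_gap q).
Proof.
apply: measurable_funB.
  exact: (@measurable_mean _ _ _ _ D (vloss q) (vloss01 q) (measurable_vloss q)).
apply: measurable_funM => //; apply: measurable_sum => j.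
have mg : measurable_fun [set: m.-tuple (X * bool)] (fun S => (S, tnth S j)).
  by apply: measurable_fun_pair => //; exact: measurable_tnth.
exact: (measurableT_comp (measurable_vloss q) mg).
Qed.

(** Negating the voter turns each of the two risks [r] into [1 - r], and the ones cancel in the
    difference. *)
Lemma risk_gap_neg i sig S : risk_gap (i, negsig sig) S = - risk_gap (i, sig) S.
Proof.
rewrite /risk_gap /= Rc_sc.
under eq_Rintegral do rewrite lossN.
under eq_bigr do rewrite lossN.
have mS : measurable_fun setT (vloss (i, sig) S).
  exact: (measurableT_comp (measurable_vloss (i, sig)) (measurable_pair1 S)).
rewrite RintegralB//; last 2 first.
- by apply: probability_integrable01 => // z; rewrite ler01 lexx.
- exact: (probability_integrable01 _ _ _ D _ mS (vloss01 (i, sig) S)).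
rewrite Rintegral_cst// [X in fine X]probability_setT mul1r.
rewrite sumrB sumr_const card_ord mulrBr -[1 *+ m]/(m%:R) mulVf.
  by rewrite -[fine 1]/(1 : R); ring.
by rewrite pnatr_eq0 -lt0n (leq_ltn_trans _ lam_lt_m).
Qed.

Lemma integral_exp_risk_gap q :
  (\int[Dm]_S (expR (2 * (m - lam)%:R * risk_gap q S ^+ 2))%:E
   <= (expR (4 * lam%:R) * xi (m - lam))%:E)%E.
Proof.
have n0 : (0 < m - lam)%N by rewrite subn_gt0.
have [L [uL sL LP]] := exists_uniq_avoiding m lam _ (tagged q.1) (ltn_ord (tag q.1)).
have mw := measurable_vloss q.
have mp := @measurable_mean _ _ _ _ D (vloss q) (vloss01 q) mw.
have mwi j : measurable_fun [set: m.-tuple (X * bool)] (fun S => vloss q S (tnth S j)).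
  have mg : measurable_fun [set: m.-tuple (X * bool)] (fun S => (S, tnth S j)).
    by apply: measurable_fun_pair => //; exact: measurable_tnth.
  exact: (measurableT_comp mw mg).
have mV : measurable_fun [set: m.-tuple (X * bool)]
    (fun S => \sum_(j <- L) vloss q S (tnth S j)) by exact: measurable_sum.
have mdev := measurableT_comp (measurable_exp_sqdev (m - lam))
  (measurable_fun_pair mp mV).
apply: (@le_trans _ _ (\int[Dm]_S ((expR (4 * lam%:R))%:E *
    (exp_sqdev (m - lam) (\int[D]_z vloss q S z)
       (\sum_(j <- L) vloss q S (tnth S j)))%:E))%E); last first.
  rewrite ge0_integralZl_EFin ?expR_ge0//; last 2 first.
  - by move=> S _; rewrite lee_fin expR_ge0.
  - by apply/measurable_EFinP; exact: mdev.
  rewrite EFinM lee_wpmul2l ?lee_fin ?expR_ge0// -sL.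
  apply: integral_exp_sqdev_le_xi => //; first by rewrite sL.
  move=> j S z jL; apply/funext => y.
  by rewrite /vloss subsample_set_tnth// LP.
apply: ge0_le_integral => //.
- apply/measurable_EFinP; apply: (measurableT_comp (@measurable_expR R)).
  apply: measurable_funM => //; apply: measurable_funX; exact: measurable_risk_gap.
- apply/measurable_EFinP.
  exact: (measurable_funM (measurable_cst (expR (4 * lam%:R))) mdev).
move=> S _; rewrite -EFinM lee_fin /risk_gap.
have -> : m%:R = (m - lam + lam)%:R :> R by rewrite subnK// ltnW.
apply: exp_sqdev_drop => //.
- exact: (@mean01 _ _ _ _ D (vloss q) (vloss01 q) mw).
- apply/andP; split; first by apply: sumr_ge0 => j _; case/andP: (vloss01 q S (tnth S j)).
  rewrite -sL -sum1_size natr_sum; apply: ler_sum => j _.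
  by case/andP: (vloss01 q S (tnth S j)).
(* Exactly [lam] indices lie outside [L], and each contributes a loss in [[0, 1]]. *)
- rewrite -[X in _ <= X <= _]/(\sum_(j < m) vloss q S (tnth S j)).
  rewrite [X in _ <= X <= _](bigID (mem L))/= (big_uniq _ uL)/= lerD2l lerDl.
  apply/andP; split.
    by apply: sumr_ge0 => j _; case/andP: (vloss01 q S (tnth S j)).
  apply: (@le_trans _ _ (\sum_(j < m | j \notin L) 1)%N%:R).
    by rewrite natr_sum; apply: ler_sum => j _; case/andP: (vloss01 q S (tnth S j)).
  rewrite ler_nat sum1_card.
  have := cardC (mem L); rewrite card_ord (card_uniqP uL) sL => E.
  by rewrite -(leq_add2l (m - lam)) E subnK// ltnW.
Qed.

End RiskGap.

(** * From one voter to all aligned posteriors *)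

Theorem mainTheorem17 (R : realType) (d : measure_display) (X : measurableType d)
  (m lam : nat)
  (Rc : seq (X * bool) -> lam.-tuple bool -> X -> R)
  (Rc_sc : self_complemented Rc)
  (Rc_bnd : forall s sig x, -1 <= Rc s sig x <= 1)
  (Rc_meas : forall (k : nat) (sig : lam.-tuple bool),
     measurable_fun setT (fun tx : k.-tuple (X * bool) * X => Rc (val tx.1) sig tx.2))
  (lam_lt_m : (lam < m)%N)
  (D : probability (X * bool)%type R)
  (Dm : probability (m.-tuple (X * bool)) R)
  (Dm_prod : is_iid_product D Dm)
  (P : msg_space m lam -> R) (P_dist : is_fdist P)
  (delta : R) (delta_pos : 0 < delta) (delta_le1 : delta <= 1) :
  exists E : set (m.-tuple (X * bool)),
    measurable E /\ ((1 - delta)%:E <= Dm E)%E /\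
    forall S, E S ->
      forall Q : msg_space m lam -> R, is_fdist Q -> aligned Q P ->
        true_risk D Rc Q S <=
        emp_risk Rc Q S +
        Num.sqrt (((m - lam)%:R *+ 2)^-1 *
                  (4 * lam%:R + ln (xi (m - lam) / delta))).
Proof.
pose n := (m - lam)%N; pose K : R := expR (4 * lam%:R) * xi n.
have n0 : (0 < n)%N by rewrite subn_gt0.
have K0 : 0 < K by rewrite mulr_gt0 ?expR_gt0 ?xi_gt0.
pose gap (q : msg_space m lam) (S : m.-tuple (X * bool)) := risk_gap Rc D q S.
pose G (S : m.-tuple (X * bool)) :=
  \sum_(q : msg_space m lam) P q * expR (2 * n%:R * gap q S ^+ 2).
have [P0 P1] := P_dist.
have mexp q : measurable_fun [set: m.-tuple (X * bool)]
    (fun S => expR (2 * n%:R * gap q S ^+ 2)).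
  apply: (measurableT_comp (@measurable_expR R)).
  by apply: measurable_funM => //; apply: measurable_funX; exact: measurable_risk_gap.
have mG : measurable_fun [set: m.-tuple (X * bool)] G.
  by apply: measurable_sum => q; exact: measurable_funM.
have G0 S : 0 <= G S.
  by apply: sumr_ge0 => q _; rewrite mulr_ge0 ?expR_ge0.
have intG : (\int[Dm]_S (G S)%:E <= K%:E)%E.
  under eq_integral do rewrite -sumEFin.
  rewrite ge0_integral_sum//; last 2 first.
  - by move=> q; apply/measurable_EFinP; exact: measurable_funM.
  - by move=> q S _; rewrite lee_fin mulr_ge0 ?expR_ge0.
  apply: (@le_trans _ _ (\sum_(q : msg_space m lam) (P q * K)%:E)%E).
    apply: lee_sum => q _; under eq_integral do rewrite EFinM.
    rewrite ge0_integralZl_EFin//; last by apply/measurable_EFinP; exact: mexp.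
    by rewrite EFinM lee_wpmul2l ?lee_fin//; exact: integral_exp_risk_gap.
  by rewrite sumEFin -big_distrl/= P1 mul1r.
(* The event involves only the prior, so it serves all posteriors at once. *)
exists [set S | G S <= K / delta]; split.
  rewrite (_ : [set S | _] = G @^-1` `]-oo, K / delta]).
    by rewrite -[X in measurable X]setTI; exact: mG.
  by apply/seteqP; split => S; rewrite /= in_itv.
split; first exact: probability_le_markov.
move=> S /= GS Q Q_dist QP.
rewrite -lerBlDl.
have -> : true_risk D Rc Q S - emp_risk Rc Q S = \sum_(q : msg_space m lam) Q q * gap q S.
  rewrite /true_risk /emp_risk -sumrB; apply: eq_bigr => q _.
  by rewrite -mulrBr.
set Delta := \sum_q _.
(* Squaring comes first: [gap] is odd under negation, and only its square allows [Q] to be exchanged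
   for [P]. *)
have D2 : Delta ^+ 2 <= \sum_(q : msg_space m lam) P q * gap q S ^+ 2.
  apply: le_trans (sqr_mean_le _ _ _ Q_dist) _.
  rewrite (aligned_sum_even _ _ _ _ (fun q => gap q S ^+ 2) QP)// => i s.
  by rewrite /gap risk_gap_neg// sqrrN.
have eG : expR (2 * n%:R * Delta ^+ 2) <= K / delta.
  apply: le_trans GS; apply: le_trans (expR_mean_le _ _ _ P_dist).
  rewrite ler_expR; under eq_bigr do rewrite mulrCA.
  by rewrite -big_distrr/= ler_wpM2l ?mulr_ge0.
(* Taking logarithms turns the factor [expR (4 * lam%:R)] of [K] into the summand [4 * lam%:R]. *)
have {}eG : 2 * n%:R * Delta ^+ 2 <= 4 * lam%:R + ln (xi n / delta).
  rewrite -ler_expR expRD lnK; last by rewrite posrE divr_gt0 ?xi_gt0.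
  by rewrite mulrA.
apply: le_trans (ler_norm _) _; rewrite -sqrtr_sqr ler_wsqrtr//.
have n2 : 0 < n%:R *+ 2 :> R by rewrite pmulrn_lgt0 ?ltr0n.
by rewrite mulrC ler_pdivlMr// mulrC -mulr_natl.
Qed.
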